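(* Let $(P,\le)$ be a finite partially ordered set and let $\mathcal{F}$ be the free commutative monoid on the set of irreducible upper sets of $P$. Then the monoid morphism $\varphi:\mathcal{F}\to\mathrm{M}(P)$ induced by $I\mapsto\chi_I$ is surjective. Moreover, the set of pairs $$\Bigl(I+J,\ \sum_{U\in\mathcal{U}}U+\sum_{V\in\mathcal{V}}V\Bigr),$$ where $I,J$ range over all pairs of irreducible upper sets such that $\{I,J\}$ is not a near-chain (that is, $I\cap J\neq\emptyset$, $I\not\subseteq J$ and $J\not\subseteq I$), and where $I\cap J=\dot\bigcup_{U\in\mathcal{U}}U$ and $I\cup J=\dot\bigcup_{V\in\mathcal{V}}V$ are the decompositions of $I\cap J$ and $I\cup J$ as disjoint unions of irreducible upper sets, is a canonical basis of the kernel congruence $\ker\varphi=\{(x,y)\in\mathcal{F}^2\mid\varphi(x)=\varphi(y)\}$ with respect to the order $\preceq$.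
   Context: $\mathrm{M}(P)$ is the monoid (under pointwise addition) of functions $f:P\to\mathbb{N}=\{0,1,\dots\}$ with $f(a)\le f(b)$ whenever $a\le b$. An upper set is a subset $U\subseteq P$ closed upward; an irreducible upper set is a nonempty upper set that is not the union of two disjoint nonempty upper sets. Every upper set is, uniquely, a disjoint union of irreducible upper sets. $\chi_I$ is the indicator function of $I$. A near-chain is a set of irreducible upper sets any two of which are either nested or disjoint. Elements of $\mathcal{F}$ are formal sums $\sum_{I\in\mathcal{I}} a_I I$ with $a_I\in\mathbb{N}$. The degree of such a sum is $\sum_I a_I|I|$. Fix a total order on the irreducible upper sets refining the order by cardinality (if $|I|<|J|$ then $I$ comes before $J$). The order $\preceq$ on $\mathcal{F}$: $x\preceq y$ if $\deg x<\deg y$, or $\deg x=\deg y$ and $x$ is smaller than or equal to $y$ in the reverse lexicographic order induced by the fixed order on generators. A canonical basis of a congruence $\sigma$ on $\mathcal{F}$ with respect to $\preceq$ is a set of pairs $(a,b)\in\sigma$ with $b\prec a$ that generates $\sigma$ and solves the word problem: repeatedly rewriting $c+a\to c+b$ using these pairs always terminates, and each $\sigma$-class contains exactly one element to which no rewriting applies (its normal form, the $\preceq$-least element of the class). *)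

(* Defs.v *)
From HB Require Import structures.
From mathcomp Require Export all_boot all_order all_algebra.

Set Implicit Arguments.
Unset Strict Implicit.
Unset Printing Implicit Defensive.

Import Order.TTheory GRing.Theory.
Local Open Scope ring_scope.

Section UpperSets.
Variables (d : Order.disp_t) (P : finPOrderType d).

Definition upper_set (U : {set P}) : bool :=
  [forall a, forall b, (a \in U) && (a <= b)%O ==> (b \in U)].

Definition irreducible_upper_set (U : {set P}) : bool :=
  [&& upper_set U, U != set0
    & ~~ [exists A : {set P}, exists B : {set P},
           [&& upper_set A, upper_set B, A != set0, B != set0,
               [disjoint A & B] & U == A :|: B]]].

Record irr_upper : Type := IrrUpper {
  irr_set :> {set P};
  irr_setP : irreducible_upper_set irr_set }.

HB.instance Definition _ := [isSub for irr_set].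
HB.instance Definition _ := [Finite of irr_upper by <:].

Definition near_chain (N : {set irr_upper}) : bool :=
  [forall I in N, forall J in N,
    [|| irr_set I \subset irr_set J, irr_set J \subset irr_set I
      | [disjoint irr_set I & irr_set J]]].

Definition irr_decomposition (D : {set irr_upper}) (A : {set P}) : Prop :=
  (forall I J, I \in D -> J \in D -> I != J ->
     [disjoint irr_set I & irr_set J])
  /\ A = \bigcup_(I in D) irr_set I.

Definition isotone : {pred {ffun P -> nat}} :=
  fun f => [forall a, forall b, (a <= b)%O ==> (f a <= f b)%N].

Fact isotone_addr_closed : addr_closed isotone.
Proof.
split=> [|f g /forallP hf /forallP hg].
  by apply/forallP=> a; apply/forallP=> b; rewrite !ffunE leqnn implybT.
apply/forallP=> a; apply/forallP=> b; apply/implyP=> ab; rewrite !ffunE.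
have /forallP/(_ b)/implyP/(_ ab) := hf a.
have /forallP/(_ b)/implyP/(_ ab) := hg a.
by move=> hgab hfab; apply: leq_add.
Qed.

HB.instance Definition _ :=
  GRing.isAddClosed.Build {ffun P -> nat} isotone isotone_addr_closed.

Record isoMonoid : Type := IsoMonoid {
  iso_fun :> {ffun P -> nat};
  iso_funP : iso_fun \in isotone }.

HB.instance Definition _ := [isSub for iso_fun].
HB.instance Definition _ := [Choice of isoMonoid by <:].
HB.instance Definition _ :=
  GRing.SubChoice_isSubNmodule.Build {ffun P -> nat} isotone isoMonoid
    isotone_addr_closed.

Fact indicator_isotone (I : irr_upper) :
  [ffun a : P => nat_of_bool (a \in irr_set I)] \in isotone.
Proof.
apply/forallP=> a; apply/forallP=> b; apply/implyP=> ab; rewrite !ffunE.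
have /and3P[/forallP/(_ a)/forallP/(_ b)] := irr_setP I.
by rewrite ab andbT; case: (a \in _) => //= ->.
Qed.

Definition chi (I : irr_upper) : isoMonoid := IsoMonoid (indicator_isotone I).

(* The free commutative monoid on the finite set of irreducible upper sets:   *)
(* x I is the coefficient of I, addition is pointwise.                        *)
Definition freeMonoid : Type := {ffun irr_upper -> nat}.

HB.instance Definition _ := GRing.Nmodule.on freeMonoid.

Definition gen (I : irr_upper) : freeMonoid :=
  [ffun J => nat_of_bool (J == I)].

Definition phi (x : freeMonoid) : isoMonoid :=
  \sum_(I : irr_upper) chi I *+ x I.

Fact phi_nmod_morphism : nmod_morphism phi.
Proof.
split=> [|x y]; rewrite /phi.
  by rewrite big1 // => I _; rewrite ffunE mulr0n.
by rewrite -big_split; apply: eq_bigr => I _; rewrite ffunE mulrnDr.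
Qed.

HB.instance Definition _ :=
  GRing.isNmodMorphism.Build freeMonoid isoMonoid phi phi_nmod_morphism.

Lemma phi_gen (I : irr_upper) : phi (gen I) = chi I.
Proof.
rewrite /phi (bigD1 I) //= big1 => [|J JI]; rewrite ffunE.
  by rewrite eqxx addr0.
by rewrite (negbTE JI).
Qed.

Definition deg (x : freeMonoid) : nat :=
  (\sum_(I : irr_upper) x I * #|irr_set I|)%N.

Variable leI : rel irr_upper.

Definition total_order_refining_card : Prop :=
  [/\ reflexive leI, antisymmetric leI, transitive leI, total leI
    & forall I J : irr_upper, (#|irr_set I| < #|irr_set J|)%N -> leI I J].

(* Reverse lexicographic comparison (as in the degree reverse lexicographic   *)
(* monomial order): at the smallest generator where the coefficients differ,  *)
(* the element with the larger coefficient is the smaller one.                *)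
Definition revlex (x y : freeMonoid) : Prop :=
  x = y \/ exists I : irr_upper,
    (y I < x I)%N /\ forall J, leI J I -> J != I -> x J = y J.

Definition degrevlex (x y : freeMonoid) : Prop :=
  (deg x < deg y)%N \/ deg x = deg y /\ revlex x y.

(* The decompositions UU and VV exist and are unique, so each pair I, J that   *)
(* is not a near-chain contributes exactly one pair (a, b).                   *)
Definition exchange_pairs (a b : freeMonoid) : Prop :=
  exists (I J : irr_upper) (UU VV : {set irr_upper}),
    [/\ ~~ near_chain [set I; J],
        irr_decomposition UU (irr_set I :&: irr_set J),
        irr_decomposition VV (irr_set I :|: irr_set J),
        a = gen I + gen J
      & b = \sum_(U in UU) gen U + \sum_(V in VV) gen V].

End UpperSets.

Section Congruences.
Variable M : nmodType.
Implicit Types (R S : M -> M -> Prop) (x y z a b c : M).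

Definition congruence S : Prop :=
  [/\ forall x, S x x,
      forall x y, S x y -> S y x,
      forall x y z, S x y -> S y z -> S x z
    & forall x y z, S x y -> S (z + x) (z + y)].

Definition generated_congruence R x y : Prop :=
  forall S, congruence S -> (forall a b, R a b -> S a b) -> S x y.

Definition kernel_congruence (N : nmodType) (f : M -> N) x y : Prop :=
  f x = f y.

Definition rewrite_step R x y : Prop :=
  exists a b c, [/\ R a b, x = c + a & y = c + b].

Definition normal_form R x : Prop := forall y, ~ rewrite_step R x y.

Record canonical_basis (le S R : M -> M -> Prop) : Prop := CanonicalBasis {
  cb_oriented : forall a b, R a b -> [/\ S a b, le b a & b <> a];
  cb_generates : forall x y, S x y <-> generated_congruence R x y;
  cb_terminates : well_founded (fun y x => rewrite_step R x y);
  cb_normal_form : forall x, exists! n, S x n /\ normal_form R n;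
  cb_least : forall x n, S x n -> normal_form R n ->
    forall y, S x y -> le n y }.

End Congruences.

(* Main.v *)
(* An exchange preserves the degree and strictly increases the sum of the     *)
(* 2 ^ |I|, so rewriting terminates; and it raises the coefficient of some    *)
(* component of the intersection of I and J, which is smaller than both, so   *)
(* it descends for the reverse lexicographic order. The normal forms are the  *)
(* elements supported by a near-chain. These are determined by their image    *)
(* f: the largest members of the support are irreducible components of        *)
(* {f > 0}, so two near-chain elements with the same image share a generator, *)
(* which can be cancelled. Surjectivity follows by peeling off {f > 0} from f *)
(* one layer at a time.                                                       *)
Require Import Defs.
From mathcomp Require Import zify.

Set Implicit Arguments.
Unset Strict Implicit.
Unset Printing Implicit Defensive.

Import Order.TTheory GRing.Theory.

(** Exchanges lie in the kernel because $\chi_I+\chi_J=\chi_{I\cap J}+\chi_{I\cup J}$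
    ([exchange_phi]). An element admits no exchange exactly when its support is a near-chain
    ([near_chain_normal], [normal_near_chain]), and every element reduces to such a one
    ([exchange_terminates], [normal_form_reachable]). Confluence is never checked on critical pairs:
    [phi] is injective on elements supported by near-chains ([near_chain_phi_inj]), so each kernel
    class has a single normal form. Two elements with the same image therefore reduce to the same
    normal form, which shows that the exchanges generate the kernel. Since every step descends
    ([step_degrevlex]), this normal form is the least element of its class. *)

Section UpperSetTheory.
Variables (d : Order.disp_t) (P : finPOrderType d).
Implicit Types (A B U : {set P}) (I J K : irr_upper P) (D : {set irr_upper P}).

(** * Irreducible upper sets, decompositions and near-chains *)

Lemma upper_setP A :
  reflect (forall a b, a \in A -> (a <= b)%O -> b \in A) (upper_set A).
Proof.
apply: (iffP forallP) => [h a b aA ab|h a].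
  by move/forallP/(_ b)/implyP: (h a); rewrite aA ab => ->.
by apply/forallP => b; apply/implyP => /andP[]; apply: h.
Qed.

Lemma upper_setU A B : upper_set A -> upper_set B -> upper_set (A :|: B).
Proof.
move=> /upper_setP hA /upper_setP hB; apply/upper_setP => a b.
by rewrite !inE => /orP[/hA h /h ->|/hB h /h ->] //; rewrite orbT.
Qed.

Lemma upper_setI A B : upper_set A -> upper_set B -> upper_set (A :&: B).
Proof.
move=> /upper_setP hA /upper_setP hB; apply/upper_setP => a b.
by rewrite !inE => /andP[/hA h /hB h'] ab; rewrite h ?h'.
Qed.

Lemma upper_set_bigcup (T : finType) (Q : pred T) (F : T -> {set P}) :
  (forall t, Q t -> upper_set (F t)) -> upper_set (\bigcup_(t | Q t) F t).
Proof.
move=> hF; apply/upper_setP => a b /bigcupP[t Qt aF] ab; apply/bigcupP.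
by exists t => //; apply: (upper_setP _ (hF t Qt)) ab.
Qed.

Lemma irr_upper_set I : upper_set I.
Proof. by have /and3P[] := irr_setP I. Qed.

Lemma irr_neq0 I : irr_set I != set0.
Proof. by have /and3P[] := irr_setP I. Qed.

Lemma irr_set_inj : injective (@irr_set d P).
Proof. exact: val_inj. Qed.

Lemma irr_split (X A B : {set P}) : irreducible_upper_set X ->
  upper_set A -> upper_set B -> [disjoint A & B] -> X = A :|: B ->
  A = set0 \/ B = set0.
Proof.
case/and3P => _ _ /existsP nX uA uB dAB XE.
case: (eqVneq A set0) => [->|A0]; first by left.
case: (eqVneq B set0) => [->|B0]; first by right.
by case: nX; exists A; apply/existsP; exists B; rewrite uA uB A0 B0 dAB XE /=.
Qed.

(** Irreducibility acts as connectedness: the traces of [I] on [A] and [B] are disjoint upper sets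
    with union [I], so one of them is empty. *)
Lemma irr_sub_or_disjoint I A B : upper_set A -> upper_set B ->
  [disjoint A & B] -> irr_set I \subset A :|: B ->
  irr_set I \subset A \/ [disjoint irr_set I & A].
Proof.
move=> uA uB dAB IAB.
have [||||h|h] := @irr_split I (I :&: A) (I :&: B) (irr_setP I).
- exact: upper_setI (irr_upper_set I) uA.
- exact: upper_setI (irr_upper_set I) uB.
- apply: disjointWl (subsetIr _ _) _; rewrite disjoint_sym.
  by apply: disjointWl (subsetIr _ _) _; rewrite disjoint_sym.
- by rewrite -setIUr; apply/esym/setIidPl.
- by right; rewrite -setI_eq0 h.
left; apply/subsetP => p pI; have := subsetP IAB p pI.
rewrite inE => /orP[//|pB].
by move/setP/(_ p): h; rewrite !inE pI pB.
Qed.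

Lemma irr_decomposition_exists A :
  upper_set A -> exists D, irr_decomposition D A.
Proof.
have [n] := ubnP #|A|; elim: n A => // n IHn A; rewrite ltnS => An uA.
have [->|A0] := eqVneq A set0.
  by exists set0; split=> [I J|]; rewrite ?big_set0 // inE.
have [iA|] := boolP (irreducible_upper_set A).
  exists [set IrrUpper iA]; split=> [I J|]; last by rewrite big_set1.
  by rewrite !inE => /eqP-> /eqP->; rewrite eqxx.
rewrite /irreducible_upper_set uA A0 /= negbK => /existsP[B /existsP[C]].
case/and5P=> uB uC B0 C0 /andP[dBC /eqP AE].
have cA : #|A| = #|B| + #|C|.
  by move: dBC; rewrite AE cardsU -setI_eq0 => /eqP->; rewrite cards0 subn0.
have hB : 0 < #|B| by rewrite card_gt0.
have hC : 0 < #|C| by rewrite card_gt0.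
have [|D [dD BE]] := IHn B _ uB; first by lia.
have [|E [dE CE]] := IHn C _ uC; first by lia.
have DE I J : I \in D -> J \in E -> [disjoint irr_set I & irr_set J].
  move=> ID JE; have IB : irr_set I \subset B by rewrite BE bigcup_sup.
  have JC : irr_set J \subset C by rewrite CE bigcup_sup.
  apply: disjointWl IB _; rewrite disjoint_sym.
  by apply: disjointWl JC _; rewrite disjoint_sym.
exists (D :|: E); split=> [I J|]; last by rewrite bigcup_setU -BE -CE.
rewrite !inE => /orP[ID|IE] /orP[JD|JE] IJ.
- exact: dD.
- exact: DE.
- by rewrite disjoint_sym; apply: DE.
- exact: dE.
Qed.

(** By disjointness at most one term is nonzero. This turns a decomposition into an identity of
    indicator functions. *)
Lemma irr_decomposition_mem D A (p : P) : irr_decomposition D A ->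
  \sum_(I in D) (p \in irr_set I) = (p \in A).
Proof.
case=> dD ->.
have [/bigcupP[I ID pI]|pN] := boolP (p \in \bigcup_(I in D) irr_set I).
  rewrite (bigD1 I) //= pI big1 // => J /andP[JD JI].
  by rewrite (disjointFl (dD _ _ JD ID JI)).
rewrite big1 // => I ID; apply/eqP; rewrite eqb0; apply: contra pN => pI.
by apply/bigcupP; exists I.
Qed.

(** The case of uniqueness used for $I\cup J$: any member [J] of [D] splits [I] into [J] and the
    union of the others, which must then be empty. *)
Lemma irr_decomposition_irr D I :
  irr_decomposition D (irr_set I) -> D = [set I].
Proof.
move=> [dD IE].
have [p pI] := set0Pn _ (irr_neq0 I).
have /bigcupP[J JD pJ] : p \in \bigcup_(K in D) irr_set K by rewrite -IE.
have dJ K : K \in D -> K != J -> [disjoint irr_set K & irr_set J].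
  by move=> KD; apply: dD.
have JI : irr_set I = J :|: \bigcup_(K in D | K != J) irr_set K.
  by rewrite IE (bigD1 J).
have D0 : \bigcup_(K in D | K != J) irr_set K = set0.
  have [|||J0|//] := irr_split (irr_setP I) _ _ _ JI.
  - exact: irr_upper_set.
  - by apply: upper_set_bigcup => K _; apply: irr_upper_set.
  - apply: bigcup_disjoint => K /andP[KD KJ].
    by rewrite disjoint_sym; apply: dJ.
  - by have := irr_neq0 J; rewrite J0 eqxx.
have IJ : I = J by apply: irr_set_inj; rewrite JI D0 setU0.
apply/setP => K; rewrite inE IJ; apply/idP/eqP => [KD|->//].
apply/eqP; apply: contraT => KJ; have [q qK] := set0Pn _ (irr_neq0 K).
by move/setP/(_ q): D0; rewrite inE => /bigcupP[]; exists K => //; rewrite KD.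
Qed.

Lemma near_chain2 I J : near_chain [set I; J] =
  [|| irr_set I \subset irr_set J, irr_set J \subset irr_set I
    | [disjoint irr_set I & irr_set J]].
Proof.
apply/idP/idP => [/forall_inP/(_ I)|h].
  rewrite !inE eqxx => /(_ isT)/forall_inP/(_ J); apply.
  by rewrite !inE eqxx orbT.
apply/forall_inP => K; rewrite !inE => /orP[]/eqP->;
  apply/forall_inP => L; rewrite !inE => /orP[]/eqP->; rewrite ?subxx //.
by rewrite disjoint_sym orbCA.
Qed.

Lemma near_chain_sub_or_disjoint D I J : near_chain D -> I \in D -> J \in D ->
  #|irr_set J| <= #|irr_set I| ->
  irr_set J \subset irr_set I \/ [disjoint irr_set J & irr_set I].
Proof.
move=> /forall_inP nc ID JD JI.
have /forall_inP/(_ J JD)/or3P[IJ|?|dIJ] := nc I ID.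
- by left; have /eqP-> : irr_set I == irr_set J by rewrite eqEcard IJ JI.
- by left.
- by right; rewrite disjoint_sym.
Qed.

(** In a splitting of the union, each of [I] and [J] lies wholly on one side. Opposite sides would
    make them disjoint; a common side would leave the other side empty. *)
Lemma crossing_setU_irr I J : ~~ [disjoint irr_set I & irr_set J] ->
  irreducible_upper_set (irr_set I :|: irr_set J).
Proof.
move=> IJ; apply/and3P; split.
- by apply: upper_setU; apply: irr_upper_set.
- have [p pI] := set0Pn _ (irr_neq0 I); apply/set0Pn.
  by exists p; rewrite inE pI.
apply/existsP => -[A /existsP[B /and5P[uA uB A0 B0 /andP[dAB /eqP UE]]]].
have side K : irr_set K \subset A :|: B ->
    [disjoint irr_set K & B] \/ [disjoint irr_set K & A].
  move=> KAB; case: (irr_sub_or_disjoint uA uB dAB KAB) => [KA|]; last by right.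
  by left; apply: disjointWl KA dAB.
have KI K X Y : irr_set K \subset X :|: Y -> [disjoint irr_set K & Y] ->
    irr_set K \subset X.
  move=> KXY dKY; apply/subsetP => p pK; have := subsetP KXY p pK.
  by rewrite inE (disjointFr dKY pK) orbF.
have IAB : irr_set I \subset A :|: B by rewrite -UE subsetUl.
have JAB : irr_set J \subset A :|: B by rewrite -UE subsetUr.
have dis X Y : irr_set I :|: irr_set J = X :|: Y -> [disjoint X & Y] ->
    X != set0 -> [disjoint irr_set I & X] -> [disjoint irr_set J & X] -> False.
  move=> E dXY /set0Pn[p pX] dI dJ.
  have : p \in irr_set I :|: irr_set J by rewrite E inE pX.
  by rewrite inE (disjointFl dI pX) (disjointFl dJ pX).
have E' : irr_set I :|: irr_set J = B :|: A by rewrite UE setUC.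
have dBA : [disjoint B & A] by rewrite disjoint_sym.
case: (side I IAB) => dI; case: (side J JAB) => dJ.
- exact: dis E' dBA B0 dI dJ.
- case/negP: IJ; apply: disjointWl (KI _ _ _ IAB dI) _; rewrite disjoint_sym.
  by [].
- case/negP: IJ; rewrite disjoint_sym; apply: disjointWl (KI _ _ _ JAB dJ) _.
  by rewrite disjoint_sym.
- exact: dis UE dAB A0 dI dJ.
Qed.

End UpperSetTheory.

(** * Additive functionals on the free monoid and the map [phi] *)

Section FreeMonoid.
Variables (d : Order.disp_t) (P : finPOrderType d).
Implicit Types (I J K : irr_upper P) (D : {set irr_upper P}).
Implicit Types (x y z a b c : freeMonoid P) (p : P) (g : irr_upper P -> nat).

Lemma freeD x y I : (x + y)%R I = x I + y I.
Proof. by rewrite ffunE. Qed.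

Lemma genE I J : gen I J = (J == I).
Proof. by rewrite ffunE. Qed.

(** One additive functional for several uses: [g] is the cardinality for [deg], membership of a
    point for the values of [phi], a Kronecker delta for coefficients, and a power of two for
    termination. *)
Definition weight g x := \sum_(I : irr_upper P) x I * g I.

Lemma weightD g x y : weight g (x + y)%R = weight g x + weight g y.
Proof.
by rewrite -big_split; apply: eq_bigr => I _; rewrite freeD mulnDl.
Qed.

Lemma weight_gen g I : weight g (gen I) = g I.
Proof.
rewrite /weight (bigD1 I) //= big1 => [|J JI]; rewrite genE.
  by rewrite eqxx mul1n addn0.
by rewrite (negbTE JI).
Qed.

Lemma weight_sum_gen g D : weight g (\sum_(I in D) gen I)%R = \sum_(I in D) g I.
Proof.
elim/big_rec2: _ => [|I m x _ IH]; last by rewrite weightD weight_gen IH.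
by rewrite /weight big1 // => I _; rewrite ffunE.
Qed.

Lemma coef_weight x I : x I = weight (fun J => I == J) x.
Proof.
rewrite /weight (bigD1 I) //= eqxx muln1 big1 ?addn0 // => J.
by rewrite eq_sym => /negbTE->; rewrite muln0.
Qed.

Lemma isoD (f h : isoMonoid P) p : (f + h)%R p = f p + h p.
Proof. by rewrite [iso_fun _](raddfD (val : isoMonoid P -> _)) ffunE. Qed.

Lemma phiE x p : phi x p = weight (fun I => p \in irr_set I) x.
Proof.
have chiMn I n : (chi I *+ n)%R p = n * (p \in irr_set I).
  elim: n => [|n IHn]; last by rewrite mulrS isoD IHn ffunE mulSn.
  by rewrite mulr0n [iso_fun _](raddf0 (val : isoMonoid P -> _)) ffunE.
rewrite /phi /weight; elim/big_rec2: _ => [|I m f _ IH].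
  by rewrite [iso_fun _](raddf0 (val : isoMonoid P -> _)) ffunE.
by rewrite isoD chiMn IH.
Qed.

Lemma phi_eqP x y : phi x = phi y <->
  forall p, weight (fun I => p \in irr_set I) x
          = weight (fun I => p \in irr_set I) y.
Proof.
split=> [h p|h]; first by rewrite -!phiE h.
by apply: val_inj; apply/ffunP => p; rewrite !phiE.
Qed.

(** Double counting of incidences between points and generators. Consequently [deg] is constant on
    kernel classes. *)
Lemma deg_phi x : deg x = \sum_p phi x p.
Proof.
under eq_bigr do rewrite phiE.
rewrite exchange_big /=; apply: eq_bigr => I _.
by rewrite -big_distrr /= -sum1_card big_mkcond.
Qed.

Definition support x : {set irr_upper P} := [set I | 0 < x I].

Lemma support_phi x p :
  (0 < phi x p) = [exists I in support x, p \in irr_set I].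
Proof.
rewrite phiE lt0n sum_nat_eq0; apply/forallPn/exists_inP => [[I]|[I]].
  rewrite /= muln_eq0 negb_or eqb0 negbK => /andP[].
  by exists I; rewrite ?inE ?lt0n.
by rewrite inE lt0n => xI pI; exists I; rewrite /= pI muln1.
Qed.

Lemma support_sub_gen x I : I \in support x -> exists y, x = (y + gen I)%R.
Proof.
(* The truncated subtraction is exact because [x I] is positive. *)
rewrite inE => xI; exists [ffun J => x J - (J == I)].
apply/ffunP => J; rewrite freeD genE ffunE; case: eqP => [->|_] /=; lia.
Qed.

Lemma supportD x y : support (x + y)%R = support x :|: support y.
Proof. by apply/setP => I; rewrite !inE freeD addn_gt0. Qed.

Lemma support_gen I : support (gen I) = [set I].
Proof. by apply/setP => J; rewrite !inE genE lt0b. Qed.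

Lemma near_chainS D D' : D \subset D' -> near_chain D' -> near_chain D.
Proof.
move=> sDD' /forall_inP h; apply/forall_inP => I /(subsetP sDD')/h.
by move/forall_inP=> h'; apply/forall_inP => J /(subsetP sDD')/h'.
Qed.

(** * Exchange rewriting, its normal forms, and the image of [phi] *)

Lemma near_chain_normal x :
  near_chain (support x) -> normal_form (@exchange_pairs d P) x.
Proof.
move=> ncx y [a [b [c [[I [J [UU [VV [nIJ _ _ -> _]]]]] xE _]]]].
case/negP: nIJ; apply: near_chainS ncx; rewrite xE !supportD !support_gen.
exact: subsetUr.
Qed.

Lemma exchange_step_exists x : ~~ near_chain (support x) ->
  exists y, rewrite_step (@exchange_pairs d P) x y.
Proof.
case/forall_inPn => I xI /forall_inPn[J xJ]; rewrite -near_chain2 => nIJ.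
(* Distinctness keeps [J] in the support once one copy of [I] is removed. *)
have IJ : J != I by apply: contraNneq nIJ => ->; rewrite near_chain2 subxx.
have [y xE] := support_sub_gen xI.
have [|z yE] := @support_sub_gen y J.
  move: xJ; rewrite xE supportD support_gen !in_setU in_set1.
  by rewrite (negbTE IJ) orbF.
have [UU hU] := irr_decomposition_exists
  (upper_setI (irr_upper_set I) (irr_upper_set J)).
have [VV hV] := irr_decomposition_exists
  (upper_setU (irr_upper_set I) (irr_upper_set J)).
exists (z + (\sum_(U in UU) gen U + \sum_(V in VV) gen V))%R.
exists (gen I + gen J)%R, (\sum_(U in UU) gen U + \sum_(V in VV) gen V)%R, z.
split=> //; first by exists I, J, UU, VV.
by rewrite xE yE -addrA [(gen J + _)%R]addrC.
Qed.

Lemma normal_near_chain x :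
  normal_form (@exchange_pairs d P) x -> near_chain (support x).
Proof.
by move=> nx; apply: contraT => /exchange_step_exists[y /nx].
Qed.

Lemma exchange_phi a b : exchange_pairs a b -> phi a = phi b.
Proof.
move=> [I [J [UU [VV [_ hU hV -> ->]]]]]; apply/phi_eqP => p.
rewrite !weightD !weight_gen !weight_sum_gen.
rewrite (irr_decomposition_mem p hU) (irr_decomposition_mem p hV) !inE.
by case: (p \in _); case: (p \in _).
Qed.

Lemma step_phi x y : rewrite_step (@exchange_pairs d P) x y -> phi x = phi y.
Proof.
by move=> [a [b [c [/exchange_phi h -> ->]]]]; rewrite !raddfD /= h.
Qed.

Lemma deg_eq_phi x y : phi x = phi y -> deg x = deg y.
Proof. by rewrite !deg_phi => ->. Qed.

(* A quadratic weight would not do: splitting I :&: J may lose more than      *)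
(* merging I and J into I :|: J gains.                                        *)
Lemma exchange_weight a b : exchange_pairs a b ->
  weight (fun I => 2 ^ #|irr_set I|) a < weight (fun I => 2 ^ #|irr_set I|) b.
Proof.
move=> [I [J [UU [VV [nIJ hU hV -> ->]]]]].
move: nIJ; rewrite near_chain2 !negb_or => /and3P[nIJ nJI ndIJ].
rewrite !weightD !weight_gen !weight_sum_gen.
have iIJ := crossing_setU_irr ndIJ.
rewrite (@irr_decomposition_irr _ _ VV (IrrUpper iIJ)) // big_set1 /=.
have UU0 : 0 < \sum_(U in UU) 2 ^ #|irr_set U|.
  move: ndIJ; rewrite -setI_eq0 hU.2 => /set0Pn[p /bigcupP[U UUU _]].
  by rewrite (bigD1 U) //= addn_gt0 expn_gt0.
have lt1 : #|irr_set I| < #|irr_set I :|: irr_set J|.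
  by apply: proper_card; rewrite properE subsetUl subUset subxx.
have lt2 : #|irr_set J| < #|irr_set I :|: irr_set J|.
  by apply: proper_card; rewrite properE subsetUr subUset subxx andbT.
(* With $|I\cup J|=n+1$, the term $2^{n+1}=2^n+2^n$ dominates $2^{|I|}+2^{|J|}$; strictness comes
   from the nonempty intersection. *)
case: #|_ :|: _| lt1 lt2 => // n; rewrite !ltnS => lt1 lt2; rewrite expnS.
rewrite -add1n mul2n -addnn; apply: leq_add UU0 _.
by apply: leq_add; rewrite leq_exp2l.
Qed.

(** Since [deg] is invariant under exchanges, this crude bound caps a weight that grows at every
    step. *)
Lemma weight_pow_le x :
  weight (fun I => 2 ^ #|irr_set I|) x <= deg x * 2 ^ #|P|.
Proof.
rewrite /weight /deg big_distrl /=; apply: leq_sum => I _; rewrite -mulnA.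
rewrite leq_mul2l; apply/orP; right.
apply: leq_trans (leq_pexp2l _ (max_card _)) (leq_pmull _ _) => //.
by rewrite card_gt0 irr_neq0.
Qed.

Lemma exchange_terminates :
  well_founded (fun y x => rewrite_step (@exchange_pairs d P) x y).
Proof.
pose m x := deg x * 2 ^ #|P| - weight (fun I => 2 ^ #|irr_set I|) x.
have m_dec x y : rewrite_step (@exchange_pairs d P) x y -> m y < m x.
  move=> xy; have dxy := deg_eq_phi (step_phi xy).
  have := weight_pow_le x; have := weight_pow_le y; rewrite /m dxy.
  by move: xy => [a [b [c [/exchange_weight h -> ->]]]]; rewrite !weightD; lia.
(* [done] would loop on an [Acc] goal, by repeatedly applying [Acc_intro]. *)
move=> x; have [n] := ubnP (m x).
elim: n x => [x|n IHn x hx]; first by rewrite ltn0.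
by constructor=> y /m_dec xy; apply: IHn; apply: leq_trans xy hx.
Qed.

(** The abstract preorder [T] stands in for the reflexive transitive closure of rewriting, so that
    every property preserved along a reduction is obtained by choosing [T]. *)
Lemma normal_form_reachable (T : freeMonoid P -> freeMonoid P -> Prop) x :
  (forall y, T y y) -> (forall w y z, T w y -> T y z -> T w z) ->
  (forall y z, rewrite_step (@exchange_pairs d P) y z -> T y z) ->
  exists n, T x n /\ normal_form (@exchange_pairs d P) n.
Proof.
move=> Tr Tt Ts; elim/(well_founded_ind exchange_terminates): x => x IHx.
have [/near_chain_normal nx|] := boolP (near_chain (support x)).
  by exists x.
case/exchange_step_exists => y xy; have [n [yn nn]] := IHx y xy.
by exists n; split=> //; apply: Tt yn; apply: Ts.
Qed.

(* The maximal members of the support of a near-chain are the irreducible     *)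
(* components of the support of its image, hence are determined by the image. *)
Lemma near_chain_top x y I : near_chain (support x) -> near_chain (support y) ->
  phi x = phi y -> I \in support x ->
  (forall J, J \in support x -> #|irr_set J| <= #|irr_set I|) ->
  I \in support y.
Proof.
move=> ncx ncy exy xI maxI.
(* By maximality of [I], the other members of the support of [x] lie inside [I] or are disjoint from
   it. So $\{f>0\}$, with [f] the common image, is the disjoint union of [I] and [R], and each
   generator of [y] lies in [I] or misses it. *)
pose R := \bigcup_(K in support x | [disjoint irr_set K & irr_set I]) irr_set K.
have uR : upper_set R by apply: upper_set_bigcup => K _; apply: irr_upper_set.
have dIR : [disjoint irr_set I & R].
  by apply: bigcup_disjoint => K /andP[_]; rewrite disjoint_sym.
have yI L : L \in support y ->
    irr_set L \subset irr_set I \/ [disjoint irr_set L & irr_set I].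
  move=> yL; apply: irr_sub_or_disjoint (irr_upper_set I) uR dIR _.
  apply/subsetP => p pL; have : 0 < phi x p.
    by rewrite exy support_phi; apply/exists_inP; exists L.
  rewrite support_phi inE => /exists_inP[K xK pK].
  have [KI|dKI] := near_chain_sub_or_disjoint ncx xI xK (maxI K xK).
    by rewrite (subsetP KI).
  by apply/orP; right; apply/bigcupP; exists K => //; apply/andP.
have ycov p : p \in irr_set I ->
    exists L, [/\ L \in support y, p \in irr_set L
                & irr_set L \subset irr_set I].
  move=> pI; have : 0 < phi y p.
    by rewrite -exy support_phi; apply/exists_inP; exists I.
  rewrite support_phi => /exists_inP[L yL pL]; exists L; split=> //.
  by case: (yI L yL) => // /disjointFr/(_ pL); rewrite pI.
have [p pI] := set0Pn _ (irr_neq0 I); have [L0 [yL0 _ L0I]] := ycov p pI.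
pose Q := [pred L | (L \in support y) && (irr_set L \subset irr_set I)].
have QL0 : Q L0 by rewrite /= yL0.
case: (arg_maxnP (fun L : irr_upper P => #|irr_set L|) QL0).
move=> K /andP[yK KI] maxK.
(* The generators of [y] inside [I] cover [I], and each lies in the largest one [K] or is disjoint
   from it. Irreducibility of [I] then forces [S] to be empty. *)
pose S := \bigcup_(L | Q L && [disjoint irr_set L & irr_set K]) irr_set L.
have IE : irr_set I = irr_set K :|: S.
  apply/eqP; rewrite eqEsubset subUset KI /=; apply/andP; split; last first.
    by apply/bigcupsP => L /andP[/andP[]].
  apply/subsetP => q qI; have [L [yL qL LI]] := ycov q qI.
  have QL : Q L by rewrite /= yL.
  have [LK|dLK] := near_chain_sub_or_disjoint ncy yK yL (maxK L QL).
    by rewrite inE (subsetP LK).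
  by rewrite inE; apply/orP; right; apply/bigcupP; exists L => //; rewrite QL.
have [|||K0|S0] := irr_split (irr_setP I) _ _ _ IE.
- exact: irr_upper_set.
- by apply: upper_set_bigcup => L _; apply: irr_upper_set.
- by apply: bigcup_disjoint => L /andP[_]; rewrite disjoint_sym.
- by have := irr_neq0 K; rewrite K0 eqxx.
by have -> : I = K by apply: irr_set_inj; rewrite IE S0 setU0.
Qed.

Lemma near_chain_phi_inj x y : near_chain (support x) ->
  near_chain (support y) -> phi x = phi y -> x = y.
Proof.
have [n] := ubnP (deg x); elim: n x y => // n IHn x y; rewrite ltnS => dx.
move=> ncx ncy exy; have [x0|[I0 xI0]] := set_0Vmem (support x).
  have xz J : x J = 0.
    by apply/eqP; rewrite eqn0Ngt; move/setP/(_ J): x0; rewrite !inE => ->.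
  apply/ffunP => J; rewrite xz; apply/eqP.
  rewrite eq_sym eqn0Ngt; apply/negP => yJ.
  have : deg y = 0 by rewrite -(deg_eq_phi exy) /deg big1 // => K _; rewrite xz.
  move/eqP; rewrite sum_nat_eq0 => /forallP/(_ J) /=.
  by rewrite muln_eq0 cards_eq0 (negbTE (irr_neq0 J)) orbF eqn0Ngt yJ.
(* A largest generator of [x] also occurs in [y]. Cancelling it keeps both supports near-chains and
   the images equal, and lowers the degree. *)
case: (arg_maxnP (fun I : irr_upper P => #|irr_set I|) xI0) => I xI maxI.
have yI := near_chain_top ncx ncy exy xI maxI.
have [x' xE] := support_sub_gen xI; have [y' yE] := support_sub_gen yI.
rewrite xE yE; congr (_ + _)%R; apply: IHn.
- apply: leq_trans dx; rewrite xE /deg -!/(weight _ _) weightD weight_gen.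
  by rewrite -[X in X < _]addn0 ltn_add2l card_gt0 irr_neq0.
- by apply: near_chainS ncx; rewrite xE supportD subsetUl.
- by apply: near_chainS ncy; rewrite yE supportD subsetUl.
apply/phi_eqP => p; move/phi_eqP/(_ p): exy.
by rewrite xE yE !weightD => /addIn.
Qed.

Lemma phi_surjective (f : isoMonoid P) : exists x, phi x = f.
Proof.
have [n] := ubnP (\sum_p f p); elim: n f => // n IHn f; rewrite ltnS => fn.
have f_iso p q : (p <= q)%O -> f p <= f q.
  by move=> pq; have /forallP/(_ p)/forallP/(_ q)/implyP/(_ pq) := iso_funP f.
pose A : {set P} := [set p | 0 < f p].
have uA : upper_set A.
  by apply/upper_setP => a b; rewrite !inE => fa /f_iso; apply: leq_trans.
have [D hD] := irr_decomposition_exists uA.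
have [p0 | [p pA]] := set_0Vmem A.
  exists 0%R; apply: val_inj; apply/ffunP => p.
  rewrite [LHS]phiE /weight big1 => [|I _]; last by rewrite ffunE.
  by apply/esym/eqP; rewrite eqn0Ngt; move/setP/(_ p): p0; rewrite !inE => ->.
(* As the predecessor of 0 is 0, this function is $f-\chi_A$. *)
have g_iso : [ffun p => (f p).-1] \in @isotone d P.
  apply/forallP => a; apply/forallP => b; apply/implyP => ab; rewrite !ffunE.
  by have := f_iso a b ab; lia.
have [|x xg] := IHn (IsoMonoid g_iso).
  apply: leq_trans fn; rewrite (bigD1 p) //= [X in _ < X](bigD1 p) //= ffunE.
  rewrite -addSn; apply: leq_add; first by move: pA; rewrite inE; lia.
  by apply: leq_sum => q _; rewrite ffunE leq_pred.
exists (x + \sum_(I in D) gen I)%R; apply: val_inj; apply/ffunP => q.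
rewrite [LHS]phiE weightD weight_sum_gen (irr_decomposition_mem q hD).
by rewrite -phiE xg ffunE inE; case: (f q) => //= k; rewrite addn1.
Qed.

(** * Descent for the degree reverse lexicographic order *)

Section Order.
Variables (leI : rel (irr_upper P)) (hleI : total_order_refining_card leI).

(** Let [U] be a component of $I\cap J$ and [K] the first generator where [a] and [b] differ. They
    differ at [U], so $|K|\le|U|$, which is less than $|I|$ and $|J|$; hence [a] vanishes at [K] and
    [b] does not. *)
Lemma exchange_revlex a b : exchange_pairs a b ->
  exists K, a K < b K /\ forall J, leI J K -> J != K -> b J = a J.
Proof.
have [leIxx leI_anti leI_trans leI_total leI_card] := hleI.
move=> [I [J [UU [VV [nIJ hU _ aE bE]]]]].
move: nIJ; rewrite near_chain2 !negb_or => /and3P[nIJ nJI].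
rewrite -setI_eq0 => /set0Pn[p]; rewrite hU.2 => /bigcupP[U UUU _].
have UIJ : irr_set U \subset irr_set I :&: irr_set J.
  by rewrite hU.2 bigcup_sup.
have ltUI : #|irr_set U| < #|irr_set I|.
  apply: proper_card; apply: sub_proper_trans UIJ _.
  by rewrite properE subsetIl subsetI subxx.
have ltUJ : #|irr_set U| < #|irr_set J|.
  apply: proper_card; apply: sub_proper_trans UIJ _.
  by rewrite properE subsetIr subsetI subxx andbT.
have a0 K : #|irr_set K| <= #|irr_set U| -> a K = 0.
  move=> KU; rewrite aE freeD !genE; case: eqP => [KI|_].
    by move: ltUI; rewrite -KI ltnNge KU.
  by case: eqP => // KJ; move: ltUJ; rewrite -KJ ltnNge KU.
have bU : 0 < b U.
  by rewrite coef_weight bE weightD weight_sum_gen (bigD1 U) //= eqxx.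
have QU : a U != b U by rewrite a0 // eq_sym -lt0n.
case: (@extremumP _ _ leI U (fun K => a K != b K) id
         leIxx leI_trans leI_total QU) => K /= QK minK.
have KU : #|irr_set K| <= #|irr_set U|.
  rewrite leqNgt; apply/negP => UK.
  have KU : K = U by apply: leI_anti; rewrite minK // leI_card.
  by rewrite KU ltnn in UK.
exists K; split=> [|L LK KL]; first by move: QK; rewrite a0 // eq_sym -lt0n.
apply/esym/eqP; apply: contraNT KL => /minK KL.
by apply/eqP/leI_anti; rewrite LK.
Qed.

Lemma step_degrevlex x y :
  rewrite_step (@exchange_pairs d P) x y -> degrevlex leI y x.
Proof.
move=> xy; right; split; first exact/esym/deg_eq_phi/step_phi.
move: xy => [a [b [c [/exchange_revlex[K [Kab eqab]] -> ->]]]].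
right; exists K; rewrite !freeD ltn_add2l; split=> // J JK KJ.
by rewrite !freeD eqab.
Qed.

(** The earlier of the two witnesses serves for the composite; if they coincide, the two
    inequalities chain. *)
Lemma revlex_trans x y z : revlex leI x y -> revlex leI y z -> revlex leI x z.
Proof.
have [_ leI_anti leI_trans leI_total _] := hleI.
case=> [->//|[I [yxI eqI]]] [<-|[J [zyJ eqJ]]]; right; first by exists I.
have [IJ|JI] := orP (leI_total I J).
  exists I; split=> [|K KI nKI].
    have [JI|nJI] := eqVneq J I; last by rewrite -eqJ // eq_sym.
    by apply: ltn_trans yxI; rewrite -JI.
  rewrite eqI // eqJ //; first exact: leI_trans KI IJ.
  by apply: contraNneq nKI => KJ; apply/eqP/leI_anti; rewrite KI KJ IJ.
exists J; split=> [|K KJ nKJ].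
  have [IJ|nIJ] := eqVneq I J; last by rewrite eqI // eq_sym.
  by apply: ltn_trans zyJ _; rewrite -IJ.
rewrite eqI ?eqJ //; first exact: leI_trans KJ JI.
by apply: contraNneq nKJ => KI; apply/eqP/leI_anti; rewrite KJ KI JI.
Qed.

Lemma degrevlex_trans x y z :
  degrevlex leI x y -> degrevlex leI y z -> degrevlex leI x z.
Proof.
case=> [xy|[xy rxy]] [yz|[yz ryz]].
- by left; apply: ltn_trans yz.
- by left; rewrite -yz.
- by left; rewrite xy.
- by right; split; [rewrite xy | apply: revlex_trans ryz].
Qed.

End Order.

End FreeMonoid.

(** * Generated congruences and the canonical basis *)

Section Congruence.
Variables (M : nmodType) (R : M -> M -> Prop).

Lemma generated_congruence_congruence : congruence (generated_congruence R).
Proof.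
split=> [x S [h _ _ _] _|x y xy S hS RS|x y z xy yz S hS RS|x y z xy S hS RS].
- exact: h.
- by have [_ h _ _] := hS; apply: h; apply: xy.
- by have [_ _ h _] := hS; apply: h (xy S hS RS) (yz S hS RS).
- by have [_ _ _ h] := hS; apply: h; apply: xy.
Qed.

Lemma step_generated_congruence x y :
  rewrite_step R x y -> generated_congruence R x y.
Proof.
by move=> [a [b [c [ab -> ->]]]] S [_ _ _ h] RS; apply/h/RS.
Qed.

End Congruence.

Theorem theorem4 (d : Order.disp_t) (P : finPOrderType d)
    (leI : rel (irr_upper P)) (hleI : total_order_refining_card leI) :
  (forall f : isoMonoid P, exists x : freeMonoid P, phi x = f) /\
  canonical_basis (degrevlex leI)
    (kernel_congruence (@phi d P)) (@exchange_pairs d P).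
Proof.
split; first exact: phi_surjective.
pose R := @exchange_pairs d P.
have [gen_refl gen_sym gen_trans _] := generated_congruence_congruence R.
have gen_phi x y : generated_congruence R x y -> phi x = phi y.
  move/(_ (kernel_congruence (@phi d P))); apply; last exact: exchange_phi.
  rewrite /kernel_congruence; split=> // [u v w ->|u v w uv] //.
  by rewrite !raddfD /= uv.
have reach x : exists n, [/\ generated_congruence R x n, degrevlex leI n x
                           & normal_form R n].
  (* Taking for [T] both congruence and descent gives one normal form that serves for generation and
     for leastness. *)
  have [|||n [[xn nx] nn]] := @normal_form_reachable d P
    (fun x y => generated_congruence R x y /\ degrevlex leI y x) x.
  - by move=> y; split; [apply: gen_refl | right; split; [|left]].
  - move=> u v w [uv vu] [vw wv]; split; first exact: gen_trans uv vw.
    exact: degrevlex_trans hleI _ _ _ wv vu.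
  - move=> y z yz; split; first exact: step_generated_congruence.
    exact: step_degrevlex hleI _ _ yz.
  - by exists n.
have normal_inj x y : phi x = phi y -> normal_form R x -> normal_form R y ->
    x = y.
  move=> xy /normal_near_chain nx /normal_near_chain ny.
  by apply: near_chain_phi_inj.
split.
- move=> a b ab; split; first exact: exchange_phi.
    by apply: (step_degrevlex hleI); exists a, b, 0%R; rewrite !add0r.
  by move=> ba; have [K []] := exchange_revlex hleI ab; rewrite ba ltnn.
- move=> x y; split=> [xy|/gen_phi//].
  (* [x] and [y] are joined through their common normal form. *)
  have [m [xm _ nm]] := reach x; have [n [yn _ nn]] := reach y.
  have mn : m = n.
    by apply: normal_inj; rewrite // -(gen_phi _ _ xm) xy; apply: gen_phi.
  by apply: gen_trans xm _; apply: gen_sym; rewrite mn.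
- exact: exchange_terminates.
- move=> x; have [n [/gen_phi xn _ nn]] := reach x.
  exists n; split=> // m [xm nm].
  by apply: normal_inj; rewrite -?xn.
(* [y] descends to a normal form [m] of the same class, which must be [n]. *)
move=> x n xn nn y xy; have [m [/gen_phi ym my nm]] := reach y.
by rewrite (normal_inj n m) // -ym -xn.
Qed.
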